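(* Let $G$ be an independent graph. Then any double-butterfly split-and-glue with base graph $G$ yields an independent graph.
   Context: All graphs are finite and simple. Independence refers to the 3-dimensional generic rigidity matroid $\mathcal{R}_3$: $G$ is independent if the rows of the rigidity matrix of a generic framework of $G$ in $\mathbb{R}^3$ are linearly independent. Nonedge-split: given a nonedge $(a,b)$ of $G$, add new vertices $a_1,a_2$ whose neighbourhoods form an arbitrary partition of the neighbourhood of $a$, new vertices $b_1,b_2$ whose neighbourhoods form an arbitrary partition of the neighbourhood of $b$, and delete $a,b$; this gives the split graph $G^s$. The double butterfly is the graph on the eight vertices $a_1',b_1',a_2',b_2',u,v,c,c'$ with the sixteen edges: $u$ and $v$ each joined to all of $a_1',b_1',a_2',b_2'$; $c$ joined to $a_1',b_1',u,v$; $c'$ joined to $a_2',b_2',u,v$ (the union of the two butterflies, i.e. copies of $K_5$ minus two non-incident edges, on $\{a_1',b_1',c,u,v\}$ and $\{a_2',b_2',c',u,v\}$, sharing the nonedge $uv$). A double-butterfly split-and-glue with base graph $G$: perform a nonedge-split on $G$ yielding $G^s$, take a double butterfly vertex-disjoint from $G^s$, and identify $a_1,a_2,b_1,b_2$ with $a_1',a_2',b_1',b_2'$ respectively. *)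

(* Defs.v *)
From HB Require Import structures.
From mathcomp Require Import mpoly.
From mathcomp Require Import all_boot all_order all_algebra.
From mathcomp Require Import reals.

Set Implicit Arguments.
Unset Strict Implicit.
Unset Printing Implicit Defensive.

Import Order.TTheory GRing.Theory Num.Theory.
Local Open Scope ring_scope.

Record sgraph (V : finType) := SGraph {
  adj :> rel V;
  adj_sym : symmetric adj;
  adj_irr : irreflexive adj }.

Definition nbh (V : finType) (G : sgraph V) (x : V) : {set V} :=
  [set y | G x y].

Definition edges (V : finType) (G : sgraph V) : {set {set V}} :=
  [set [set x; y] | x in [set: V], y in nbh G x].

Definition framework (R : realType) (V : finType) := V -> 'rV[R]_3.

(* The 3|V| coordinates of p are algebraically independent over the rationals. *)
Definition generic (R : realType) (V : finType) (p : framework R V) : Prop :=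
  forall P : {mpoly rat[#|{: V * 'I_3}|]}, P != 0 ->
    mmap ratr (fun j => p (enum_val j).1 0 (enum_val j).2) P != 0.

(* In the row of the edge e = {x, y}, the three columns of x hold p x - p y,
   those of y hold p y - p x, and all other entries vanish: for w in e the sum
   below has a single term, indexed by the other end of e. *)
Definition rigidity_entry (R : realType) (V : finType) (p : framework R V)
    (e : {set V}) (c : V * 'I_3) : R :=
  if c.1 \in e then \sum_(w in e :\ c.1) (p c.1 0 c.2 - p w 0 c.2) else 0.

Definition rigidity_matrix (R : realType) (V : finType) (G : sgraph V)
    (p : framework R V) : 'M[R]_(#|edges G|, #|{: V * 'I_3}|) :=
  \matrix_(i < #|edges G|, j < #|{: V * 'I_3}|)
    rigidity_entry p (enum_val i) (enum_val j).

(* The rank of the rigidity matrix is the same for all generic p, and generic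
   frameworks exist because R is uncountable. *)
Definition independent (R : realType) (V : finType) (G : sgraph V) : Prop :=
  forall p : framework R V, generic p -> row_free (rigidity_matrix G p).

Inductive corner := ca1 | ca2 | cb1 | cb2.

Definition corner_code (k : corner) : bool * bool :=
  match k with
  | ca1 => (false, false) | ca2 => (false, true)
  | cb1 => (true, false) | cb2 => (true, true)
  end.

Definition corner_decode (k : bool * bool) : corner :=
  match k with
  | (false, false) => ca1 | (false, true) => ca2
  | (true, false) => cb1 | (true, true) => cb2
  end.

Lemma corner_codeK : cancel corner_code corner_decode.
Proof. by case. Qed.

HB.instance Definition _ := Finite.copy corner (can_type corner_codeK).

Inductive hub := hu | hv | hc | hc'.

Definition hub_code (h : hub) : bool * bool :=
  match h with
  | hu => (false, false) | hv => (false, true)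
  | hc => (true, false) | hc' => (true, true)
  end.

Definition hub_decode (h : bool * bool) : hub :=
  match h with
  | (false, false) => hu | (false, true) => hv
  | (true, false) => hc | (true, true) => hc'
  end.

Lemma hub_codeK : cancel hub_code hub_decode.
Proof. by case. Qed.

HB.instance Definition _ := Finite.copy hub (can_type hub_codeK).

(* N k is the set of old vertices that become the neighbours of the new vertex
   k. The parts of the two partitions may be empty. *)
Record nonedge_split (V : finType) (G : sgraph V) (a b : V)
    (N : corner -> {set V}) : Prop := NonedgeSplit {
  split_neq : a != b;
  split_nonadj : ~~ G a b;
  split_a : N ca1 :|: N ca2 = nbh G a;
  split_a_disj : [disjoint N ca1 & N ca2];
  split_b : N cb1 :|: N cb2 = nbh G b;
  split_b_disj : [disjoint N cb1 & N cb2] }.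

Definition rest (V : finType) (a b : V) : finType :=
  {x : V | x \notin [set a; b]}.

Section SplitGraph.
Variables (V : finType) (G : sgraph V) (a b : V) (N : corner -> {set V}).

Definition split_adj (x y : rest a b + corner) : bool :=
  match x, y with
  | inl s, inl t => G (val s) (val t)
  | inl s, inr k | inr k, inl s => val s \in N k
  | inr _, inr _ => false
  end.

Lemma split_adj_sym : symmetric split_adj.
Proof. by case=> [s|k] [t|l] //=; apply: adj_sym. Qed.

Lemma split_adj_irr : irreflexive split_adj.
Proof. by case=> [s|k] //=; apply: adj_irr. Qed.

Definition split_graph : sgraph (rest a b + corner)%type :=
  SGraph split_adj_sym split_adj_irr.

End SplitGraph.

Definition double_butterfly_edges :
    seq ((corner + hub)%type * (corner + hub)%type) :=
  [seq (inr h, inl k) | h <- [:: hu; hv], k <- [:: ca1; cb1; ca2; cb2]] ++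
  [seq (inr hc, x) | x <- [:: inl ca1; inl cb1; inr hu; inr hv]] ++
  [seq (inr hc', x) | x <- [:: inl ca2; inl cb2; inr hu; inr hv]].

Definition double_butterfly_adj (x y : corner + hub) : bool :=
  ((x, y) \in double_butterfly_edges) || ((y, x) \in double_butterfly_edges).

Lemma double_butterfly_adj_sym : symmetric double_butterfly_adj.
Proof. by move=> x y; rewrite /double_butterfly_adj orbC. Qed.

Lemma double_butterfly_adj_irr : irreflexive double_butterfly_adj.
Proof. by case=> [] []. Qed.

Definition double_butterfly : sgraph (corner + hub)%type :=
  SGraph double_butterfly_adj_sym double_butterfly_adj_irr.

(* The union of a graph on S + K and a graph on K + D, their vertex sets being
   otherwise disjoint, along the identity of K. *)
Section Glue.
Variables (S K D : finType).
Variables (G : sgraph (S + K)%type) (H : sgraph (K + D)%type).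

Definition glue_left (x : S + (K + D)) : option (S + K) :=
  match x with
  | inl s => Some (inl s)
  | inr (inl k) => Some (inr k)
  | inr (inr _) => None
  end.

Definition glue_right (x : S + (K + D)) : option (K + D) :=
  if x is inr z then Some z else None.

Definition glue_adj (x y : S + (K + D)) : bool :=
  (if (glue_left x, glue_left y) is (Some x', Some y') then G x' y' else false)
  ||
  (if (glue_right x, glue_right y) is (Some x', Some y') then H x' y'
   else false).

Lemma glue_adj_sym : symmetric glue_adj.
Proof.
move=> x y; rewrite /glue_adj.
by case: (glue_left x) (glue_left y) => [x1|] [y1|];
   case: (glue_right x) (glue_right y) => [x2|] [y2|];
   rewrite ?(adj_sym G x1) ?(adj_sym H x2).
Qed.

Lemma glue_adj_irr : irreflexive glue_adj.
Proof.
by case=> [s|[k|d]]; rewrite /glue_adj /= ?(adj_irr G) ?(adj_irr H).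
Qed.

Definition glue : sgraph (S + (K + D))%type := SGraph glue_adj_sym glue_adj_irr.

End Glue.

Definition double_butterfly_split_and_glue (V : finType) (G : sgraph V)
    (a b : V) (N : corner -> {set V}) :
    sgraph (rest a b + (corner + hub))%type :=
  glue (split_graph G a b N) double_butterfly.

(* Main.v *)
(* Since rank is lower semicontinuous, it suffices to find one framework of the
   glued graph without a nonzero stress. Take p generic on G and merge vertices:
   a_1, a_2 at p(a), b_1, b_2 at p(b) and c, c' at one point, so that the two
   butterflies coincide, the points a, b, u, v, c being in sufficiently general
   position. In a stress, summing the weights of coinciding edges, the vertex u
   has the three neighbours a, b, c, not coplanar with u, so the sums vanish at
   u, likewise at v, and then at c. Hence the double butterfly exerts no
   resultant force on a_1 and a_2 together, nor on b_1 and b_2, so the remaining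
   weights form a stress of G and vanish. Now a_1 has only u, v, c left as
   neighbours, similarly a_2, b_1, b_2; finally c and c' have only u, v. *)
Require Import Defs.
From mathcomp Require Import mpoly.
From mathcomp Require Import all_boot all_order all_algebra.
From mathcomp Require Import reals ring lra.

Set Implicit Arguments.
Unset Strict Implicit.
Unset Printing Implicit Defensive.

Import Order.TTheory GRing.Theory Num.Theory.
Local Open Scope ring_scope.

(** * Generic frameworks and generic rank *)

Section Genericity.
Variable R : realType.

Definition coord (V : finType) (p : framework R V)
    (j : 'I_#|{: V * 'I_3}|) : R :=
  p (enum_val j).1 0 (enum_val j).2.

Lemma mmap_mmap (A S : comNzRingType) (m n : nat) (f : {rmorphism A -> S})
    (h : 'I_m -> S) (g : 'I_n -> {mpoly A[m]}) (P : {mpoly A[n]}) :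
  mmap f h (mmap (@mpolyC m A) g P) = mmap f (fun j => mmap f h (g j)) P.
Proof.
rewrite [in RHS]/mmap [mmap _ g P]/mmap rmorph_sum; apply: eq_bigr => M _.
rewrite rmorphM /= mmapC; congr (_ * _).
by rewrite /mmap1 rmorph_prod; apply: eq_bigr => i _; rewrite rmorphXn.
Qed.

Lemma mmap_mpolyX (A : comNzRingType) (n : nat) (P : {mpoly A[n]}) :
  mmap (@mpolyC n A) (fun j => 'X_j) P = P.
Proof.
rewrite [RHS]mpolyE /mmap; apply: eq_bigr => M _.
by rewrite mmap1_id mul_mpolyC.
Qed.

Lemma mmap_rename_neq0 (A : comNzRingType) (m n : nat) (s : 'I_n -> 'I_m)
    (P : {mpoly A[n]}) :
  injective s -> P != 0 -> mmap (@mpolyC m A) (fun j => 'X_(s j)) P != 0.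
Proof.
move=> s_inj; apply: contraNneq => sP0.
(* a left inverse of the renaming, killing the variables outside its image *)
pose t i : {mpoly A[n]} := if [pick j | s j == i] is Some j then 'X_j else 0.
move/(congr1 (mmap (@mpolyC n A) t)): sP0; rewrite mmap0 mmap_mmap => tsP.
rewrite -[P]mmap_mpolyX -tsP; apply/eqP; apply: eq_bigr => M _; congr (_ * _).
apply: mmap1_eq => j; rewrite mmapX mmap1U /t.
by case: pickP => [k /eqP/s_inj->|/(_ j)]; rewrite ?eqxx.
Qed.

(** The coordinates of [p \o g] form a subfamily of those of [p], and an injective renaming of
    variables keeps a polynomial nonzero. *)
Lemma generic_comp (V W : finType) (g : V -> W) (p : framework R W) :
  injective g -> generic p -> generic (p \o g).
Proof.
move=> g_inj gen P nzP.
pose s (j : 'I_#|{: V * 'I_3}|) : 'I_#|{: W * 'I_3}| :=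
  enum_rank (g (enum_val j).1, (enum_val j).2).
have s_inj: injective s.
  move=> i j /enum_rank_inj [/g_inj e1 e2]; apply: enum_val_inj.
  by rewrite (surjective_pairing (enum_val i)) e1 e2 -surjective_pairing.
move/gen: (mmap_rename_neq0 s_inj nzP); rewrite mmap_mmap.
congr (_ != 0); apply: eq_bigr => M _; congr (_ * _).
by apply: mmap1_eq => j; rewrite mmapX mmap1U /s enum_rankK.
Qed.

Lemma generic_coord_neq (V : finType) (p : framework R V) (x y : V) (k : 'I_3) :
  generic p -> x != y -> p x 0 k != p y 0 k.
Proof.
move=> gen neq.
pose r z : 'I_#|{: V * 'I_3}| := enum_rank (z, k).
have nz: 'X_(r x) - 'X_(r y) != 0 :> {mpoly rat[#|{: V * 'I_3}|]}.
  rewrite subr_eq0; apply: contraNneq neq => /(congr1 (fun P => P@_U_(r x))).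
  rewrite !mcoeffX eqxx eq_mnm1 (inj_eq enum_rank_inj) xpair_eqE eqxx andbT.
  by rewrite eq_sym; case: (x == y) => // /eqP; rewrite oner_eq0.
by move: (gen _ nz); rewrite mmapB !mmapX !mmap1U !enum_rankK subr_eq0.
Qed.

Lemma row_free_minor (F : fieldType) (m n : nat) (A : 'M[F]_(m, n)) :
  reflect (exists f : 'I_m -> 'I_n, \det (colsub f A) != 0) (row_free A).
Proof.
apply: (iffP idP) => [freeA|[f nz]].
  have fullAT: row_full A^T by rewrite /row_full mxrank_tr.
  exists (fullrankfun fullAT).
  have := fullrowsub_unit fullAT.
  by rewrite unitmxE unitfE -det_tr; congr (\det _ != 0);
    apply/matrixP => i j; rewrite !mxE.
have uB: colsub f A \in unitmx by rewrite unitmxE unitfE.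
(* A right inverse of [A]: [colsub f 1%:M] selects the columns [f], and the resulting square block
   is inverted. *)
apply/row_freeP; exists (colsub f 1%:M *m invmx (colsub f A)).
by rewrite mulmxA mulmx_colsub mulmx1 mulmxV.
Qed.

(* A maximal minor is a rational polynomial in the coordinates. *)
Lemma row_free_generic (V : finType) (G : sgraph V) (p q : framework R V) :
  row_free (rigidity_matrix G p) -> generic q ->
  row_free (rigidity_matrix G q).
Proof.
move=> /row_free_minor [f nzp] gen; apply/row_free_minor; exists f.
pose x (c : V * 'I_3) : {mpoly rat[#|{: V * 'I_3}|]} := 'X_(enum_rank c).
pose entry (e : {set V}) (c : V * 'I_3) :=
  if c.1 \in e then \sum_(w in e :\ c.1) (x c - x (w, c.2)) else 0.
(* The rigidity matrix with indeterminate coordinates, which each framework specializes. *)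
pose M := \matrix_(i < #|edges G|, j < #|{: V * 'I_3}|)
  entry (enum_val i) (enum_val j).
have evalM (r : framework R V) :
    rigidity_matrix G r = map_mx (mmap ratr (coord r)) M.
  apply/matrixP => i j; rewrite !mxE /rigidity_entry /entry.
  case: ifP => _; last by rewrite mmap0.
  rewrite rmorph_sum; apply: eq_bigr => w _.
  by rewrite /= mmapB !mmapX !mmap1U /coord !enum_rankK.
move: nzp; rewrite !evalM -!map_mxsub !det_map_mx => nzp.
(* A minor that is zero as a polynomial would also vanish at [p]. *)
by apply: gen; apply: contraNneq nzp => ->; rewrite rmorph0.
Qed.

End Genericity.

(** * Stresses and the left kernel of the rigidity matrix *)

Section Stress.
Variables (R : realType) (V : finType) (G : sgraph V) (p : framework R V).

(** Weights sit on ordered pairs and vanish off the edges, so that equilibrium sums range over all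
    vertices and split along disjoint unions. *)
Record stress (w : V -> V -> R) : Prop := Stress {
  stress_sym : forall x y, w x y = w y x;
  stress_supp : forall x y, ~~ G x y -> w x y = 0;
  stress_eq : forall x k, \sum_y w x y * (p x 0 k - p y 0 k) = 0 }.

Lemma edgesP (e : {set V}) :
  reflect (exists x y, G x y /\ e = [set x; y]) (e \in edges G).
Proof.
apply: (iffP imset2P) => [[x y _]|[x [y [xy ->]]]].
  by rewrite inE => xy ->; exists x, y.
by exists x y; rewrite ?inE.
Qed.

(** Only edges at [x] have entries in the columns of [x], and sending [y] to [[set x; y]] is
    injective on the neighbours of [x]. *)
Lemma sum_rigidity_entry (o : {set V} -> R) (x : V) (k : 'I_3) :
  \sum_(e in edges G) o e * rigidity_entry p e (x, k) =
  \sum_(y | G x y) o [set x; y] * (p x 0 k - p y 0 k).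
Proof.
pose A := [set [set x; y] | y in nbh G x].
have xNx y: G x y -> y != x.
  by apply: contraTneq => ->; rewrite adj_irr.
rewrite (bigID (mem A)) /= [X in _ + X]big1 ?addr0; last first.
  move=> e /andP [/edgesP [y [z [yz ->]]] nA].
  rewrite /rigidity_entry /= !inE; case: ifP => [|_]; last by rewrite mulr0.
  case/orP=> /eqP xE; case/imsetP: nA; [exists z | exists y];
    by rewrite ?xE ?inE // 1?setUC // adj_sym.
rewrite (eq_bigl (mem A)) /=; last first.
  move=> e; apply/andb_idl => /imsetP [y]; rewrite inE => xy ->.
  by apply/edgesP; exists x, y.
rewrite big_imset /=; last first.
  move=> y z; rewrite !inE => /xNx yx /xNx zx /setP /(_ z).
  by rewrite !inE eqxx orbT (negPf zx) /= => /eqP.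
apply: eq_big => [y|y]; rewrite inE // => /xNx yx; congr (_ * _).
rewrite /rigidity_entry /= !inE eqxx /=.
rewrite (_ : _ :\ x = [set y]) ?big_set1 //.
apply/setP => z; rewrite !inE; case: eqP => [->|] //=.
by rewrite eq_sym (negPf yx).
Qed.

(** By [sum_rigidity_entry], stresses correspond to the row vectors killed by the rigidity
    matrix. *)
Lemma row_free_stressP :
  row_free (rigidity_matrix G p) <->
  (forall w, stress w -> forall x y, w x y = 0).
Proof.
split=> [freeM w [wC w0 weq] x y|noS].
  case Gxy: (G x y); last by apply: w0; rewrite Gxy.
  (* Both ordered pairs contribute w x y, as w x x = 0. *)
  pose o (e : {set V}) := 2^-1 * \sum_(s in e) \sum_(t in e) w s t.
  have oE s t: G s t -> o [set s; t] = w s t.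
    move=> st; have ts: s != t by apply: contraTneq st => ->; rewrite adj_irr.
    rewrite /o !big_setU1 ?big_set1 ?inE //= !big_setU1 ?big_set1 ?inE //=.
    rewrite !(w0 _ _ (negbT (adj_irr G _))) add0r addr0 [w t s]wC -mulr2n.
    by rewrite -[w s t *+ 2]mulr_natl mulKf // pnatr_eq0.
  have: (\row_i o (enum_val i)) *m rigidity_matrix G p = 0.
    apply/matrixP => i j; rewrite !mxE.
    case ej: (enum_val j) => [z k].
    transitivity (\sum_(e in edges G) o e * rigidity_entry p e (z, k)).
      by rewrite [RHS]big_enum_val; apply: eq_bigr => l _; rewrite !mxE ej.
    rewrite sum_rigidity_entry -[RHS](weq z k) [RHS](bigID (G z)) /=.
    rewrite [X in _ = _ + X]big1 ?addr0; last by move=> t /w0 ->; rewrite mul0r.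
    by apply: eq_bigr => t /oE ->.
  move/eqP; rewrite mulmx_free_eq0 // => /eqP/rowP u0.
  have xyE: [set x; y] \in edges G by apply/edgesP; exists x, y.
  move: (u0 (enum_rank_in xyE [set x; y])).
  by rewrite !mxE enum_rankK_in // oE.
apply: inj_row_free => u uM.
(* [u] as a weight on vertex sets: a single term if [e] is an edge, and 0 otherwise. *)
pose o (e : {set V}) := \sum_(i | enum_val i == e) u 0 i.
have oE i: o (enum_val i) = u 0 i.
  rewrite /o (eq_bigl (pred1 i)) ?big_pred1_eq // => j.
  by rewrite (inj_eq enum_val_inj).
pose w x y := if G x y then o [set x; y] else 0.
have /noS w0 : stress w.
  split=> [x y|x y /negPf nG|x k]; rewrite /w.
  - by rewrite adj_sym setUC.
  - by rewrite nG.
  move/matrixP/(_ 0 (enum_rank (x, k))): uM; rewrite !mxE => uM.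
  rewrite -[RHS]uM.
  transitivity (\sum_(e in edges G) o e * rigidity_entry p e (x, k)).
    rewrite sum_rigidity_entry [LHS](bigID (G x)) /=.
    rewrite [X in _ + X]big1 ?addr0; last by move=> t /negPf ->; rewrite mul0r.
    by apply: eq_bigr => t ->.
  by rewrite [LHS]big_enum_val; apply: eq_bigr => l _; rewrite !mxE enum_rankK oE.
apply/rowP => i; rewrite mxE -oE.
have /edgesP [x [y [xy ->]]] := enum_valP i.
by move: (w0 x y); rewrite /w xy.
Qed.

End Stress.

Lemma big_corner (A : nmodType) (F : corner -> A) :
  \sum_k F k = F ca1 + F ca2 + (F cb1 + F cb2).
Proof.
rewrite (reindex corner_decode) /=; last by exists corner_code => [[[] []]|[]].
rewrite (eq_bigr (fun i => F (corner_decode (i.1, i.2)))) => [|[] //].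
rewrite -(pair_bigA _ (fun i j => F (corner_decode (i, j)))) /= !big_bool /=.
by rewrite addrC; congr (_ + _); rewrite addrC.
Qed.

Lemma big_hub (A : nmodType) (F : hub -> A) :
  \sum_h F h = F hu + F hv + (F hc + F hc').
Proof.
rewrite (reindex hub_decode) /=; last by exists hub_code => [[[] []]|[]].
rewrite (eq_bigr (fun i => F (hub_decode (i.1, i.2)))) => [|[] //].
rewrite -(pair_bigA _ (fun i j => F (hub_decode (i, j)))) /= !big_bool /=.
by rewrite addrC; congr (_ + _); rewrite addrC.
Qed.

(** * The split graph and its projection onto the base graph *)

Section SplitGlue.
Variables (V : finType) (G : sgraph V) (a b : V) (N : corner -> {set V}).
Hypothesis hN : nonedge_split G a b N.

Definition corner_old (k : corner) : V :=
  match k with ca1 | ca2 => a | cb1 | cb2 => b end.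

Definition split_proj (x : rest a b + corner) : V :=
  match x with inl s => val s | inr k => corner_old k end.

Definition split_incl (x : rest a b + corner) : rest a b + (corner + hub) :=
  match x with inl s => inl s | inr k => inr (inl k) end.

Lemma rest_neq_corner (s : rest a b) (k : corner) :
  (val s == corner_old k) = false.
Proof.
by case: s => x /=; rewrite !inE negb_or; case: k => /= /andP [/negPf ? /negPf ?].
Qed.

Lemma split_nbh (k : corner) (x : V) : x \in N k -> G (corner_old k) x.
Proof.
move=> xN; case: hN => _ _ aE _ bE _.
have : x \in nbh G (corner_old k).
  by case: k xN => /= xN; rewrite -?aE -?bE inE xN ?orbT.
by rewrite inE.
Qed.

(** As [a != b], distinct corners over one old vertex carry the two disjoint parts of its
    neighbourhood. *)
Lemma split_corner_inj (k l : corner) (x : V) :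
  corner_old k = corner_old l -> x \in N k -> x \in N l -> k = l.
Proof.
case: hN => /negP ab _ _ aD _ bD kl xk xl.
have aF : x \in N ca1 -> x \in N ca2 -> False by move/(disjointFr aD)=> ->.
have bF : x \in N cb1 -> x \in N cb2 -> False by move/(disjointFr bD)=> ->.
case: k l kl xk xl => [] [] //= kl xk xl;
  try (by case: ab; rewrite kl); try (by case: aF); by case: bF.
Qed.

Lemma split_proj_adj (x y : rest a b + corner) :
  split_graph G a b N x y -> G (split_proj x) (split_proj y).
Proof. by case: x y => [s|k] [t|l] //= /split_nbh; rewrite adj_sym. Qed.

(** Projection merges no two edges: ends in [rest a b] are unchanged, and the other end of an edge
    at a corner lies in only one part of the partition. *)
Lemma split_proj_inj (x y x' y' : rest a b + corner) :
  split_graph G a b N x y -> split_graph G a b N x' y' ->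
  split_proj x' = split_proj x -> split_proj y' = split_proj y ->
  x' = x /\ y' = y.
Proof.
case: x y x' y' => [s|k] [t|l] [s'|k'] [t'|l'] //= xy xy' ex ey;
  try by [move/eqP: ex; rewrite ?rest_neq_corner // eq_sym rest_neq_corner];
  try by [move/eqP: ey; rewrite ?rest_neq_corner // eq_sym rest_neq_corner].
- by rewrite (val_inj ex) (val_inj ey).
- rewrite (val_inj ex) in xy' *; by rewrite (split_corner_inj ey xy' xy).
- rewrite (val_inj ey) in xy' *; by rewrite (split_corner_inj ex xy' xy).
Qed.

(** Corners are pairwise nonadjacent in the double butterfly, so gluing adds no edge between
    vertices of the split graph. *)
Lemma glue_incl (x y : rest a b + corner) :
  double_butterfly_split_and_glue G a b N (split_incl x) (split_incl y) =
  split_graph G a b N x y.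
Proof.
by case: x y => [s|k] [t|l]; rewrite /= /glue_adj /= ?orbF.
Qed.

(** * The degenerate framework with merged points *)

Section Degenerate.
Variables (R : realType) (p : framework R V).
Hypothesis neq0 : p a 0 0 != p b 0 0.

(* With e_1, e_2 the last two basis vectors and d = p b - p a, the triple d, e_1,
   e_2 is a basis as the first coordinate of d is nonzero, and u = a + e_2,
   v = b + e_2, c = c' = a + e_1. *)
Definition merged_hub (h : hub) : 'rV[R]_3 :=
  match h with
  | hu => \row_k (p a 0 k + (k == 2%N :> nat)%:R)
  | hv => \row_k (p b 0 k + (k == 2%N :> nat)%:R)
  | hc | hc' => \row_k (p a 0 k + (k == 1%N :> nat)%:R)
  end.

Definition merged : framework R (rest a b + (corner + hub))%type := fun x =>
  match x with
  | inl s => p (val s)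
  | inr (inl k) => p (corner_old k)
  | inr (inr h) => merged_hub h
  end.

Lemma merged_incl x : merged (split_incl x) = p (split_proj x).
Proof. by case: x. Qed.

(** Independence of d, e_1, e_2: coordinate 0 isolates [x], after which coordinates 1 and 2 give [y]
    and [z]. *)
Lemma frame_free (x y z : R) :
  (forall k : 'I_3, x * (p b 0 k - p a 0 k) + y * (k == 1%N :> nat)%:R +
     z * (k == 2%N :> nat)%:R = 0) ->
  [/\ x = 0, y = 0 & z = 0].
Proof.
move=> eq0; have d0 : p b 0 0 - p a 0 0 != 0 by rewrite subr_eq0 eq_sym.
have x0 : x = 0.
  by have /eqP := eq0 0; rewrite !mulr0 !addr0 mulf_eq0 (negPf d0) orbF => /eqP.
split=> //.
  by have := eq0 (@Ordinal 3 1 isT); rewrite x0 /= mul0r add0r mulr1 mulr0 addr0.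
by have := eq0 (@Ordinal 3 2 isT); rewrite x0 /= mul0r add0r mulr1 mulr0 add0r.
Qed.

(** * Vanishing of stresses on the merged framework *)

Section Stress.
Variable w : rest a b + (corner + hub) -> rest a b + (corner + hub) -> R.
Hypothesis stress_w : stress (double_butterfly_split_and_glue G a b N) merged w.

Let W (x y : corner + hub) := w (inr x) (inr y).

Lemma merged_rest_hub (s : rest a b) (h : hub) : w (inl s) (inr (inr h)) = 0.
Proof. exact: (stress_supp stress_w). Qed.

Lemma merged_hub_rest (h : hub) (s : rest a b) : w (inr (inr h)) (inl s) = 0.
Proof. exact: (stress_supp stress_w). Qed.

Lemma merged_butterfly_supp (x y : corner + hub) :
  ~~ double_butterfly_adj x y -> W x y = 0.
Proof.
move=> nxy; apply: (stress_supp stress_w).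
by case: x y nxy => [k|h] [l|i].
Qed.

Lemma merged_hub_eq (h : hub) (k : 'I_3) :
  \sum_l W (inr h) (inl l) * (merged_hub h 0 k - p (corner_old l) 0 k) +
  \sum_i W (inr h) (inr i) * (merged_hub h 0 k - merged_hub i 0 k) = 0.
Proof.
rewrite -[RHS](stress_eq stress_w (inr (inr h)) k) !big_sumType /=.
by rewrite [X in _ = X + _]big1 ?add0r // => s _; rewrite merged_hub_rest mul0r.
Qed.

Lemma merged_hub_hub :
  [/\ W (inr hu) (inr hv) = 0, W (inr hv) (inr hu) = 0,
      W (inr hc) (inr hc') = 0 & W (inr hc') (inr hc) = 0].
Proof. by split; apply: merged_butterfly_supp. Qed.

Lemma merged_hc_corner :
  [/\ W (inr hc) (inl ca2) = 0, W (inr hc) (inl cb2) = 0,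
      W (inr hc') (inl ca1) = 0 & W (inr hc') (inl cb1) = 0].
Proof. by split; apply: merged_butterfly_supp. Qed.

Lemma merged_hu : [/\ W (inr hu) (inl ca1) + W (inr hu) (inl ca2) = 0,
  W (inr hu) (inl cb1) + W (inr hu) (inl cb2) = 0 &
  W (inr hu) (inr hc) + W (inr hu) (inr hc') = 0].
Proof.
have [uv _ _ _] := merged_hub_hub.
set A := W _ _ + _; set B := W _ _ + W _ _; set C := W _ _ + W _ _.
(* The triple lists the coefficients of d, e_1, e_2, as u - a = e_2, u - b = e_2 - d and u - c = e_2
   - e_1. *)
suff [] : [/\ - B = 0, - C = 0 & A + B + C = 0] by split; lra.
apply: frame_free => k; have := merged_hub_eq hu k.
rewrite big_corner big_hub /= !mxE uv => <-; rewrite /A /B /C; ring.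
Qed.

Lemma merged_hv : [/\ W (inr hv) (inl ca1) + W (inr hv) (inl ca2) = 0,
  W (inr hv) (inl cb1) + W (inr hv) (inl cb2) = 0 &
  W (inr hv) (inr hc) + W (inr hv) (inr hc') = 0].
Proof.
have [_ vu _ _] := merged_hub_hub.
set A := W _ _ + _; set B := W _ _ + W _ _; set C := W _ _ + W _ _.
(* Here v - a = d + e_2, v - b = e_2 and v - c = d + e_2 - e_1. *)
suff [] : [/\ A + C = 0, - C = 0 & A + B + C = 0] by split; lra.
apply: frame_free => k; have := merged_hub_eq hv k.
rewrite big_corner big_hub /= !mxE vu => <-; rewrite /A /B /C; ring.
Qed.

(** Adding the equilibrium equations at c and c', which share a position, cancels their terms
    towards u and v by [merged_hu] and [merged_hv]. *)
Lemma merged_hc :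
  W (inr hc) (inl ca1) + W (inr hc') (inl ca2) = 0 /\
  W (inr hc) (inl cb1) + W (inr hc') (inl cb2) = 0.
Proof.
have [_ _ cc' c'c] := merged_hub_hub; have [ca2_0 cb2_0 ca1_0 cb1_0] := merged_hc_corner.
have [_ _ uc] := merged_hu; have [_ _ vc] := merged_hv.
have WC x y : W x y = W y x by apply: (stress_sym stress_w).
rewrite !(WC (inr hu)) in uc; rewrite !(WC (inr hv)) in vc.
set A := W _ _ + _; set B := W _ _ + W _ _.
(* Only c - a = e_1 and c - b = e_1 - d remain, so e_2 has coefficient 0. *)
suff [] : [/\ - B = 0, A + B = 0 & 0 = 0 :> R] by split; lra.
apply: frame_free => k.
have := merged_hub_eq hc k; have := merged_hub_eq hc' k.
rewrite !big_corner !big_hub /= !mxE cc' c'c ca1_0 ca2_0 cb1_0 cb2_0 => e' e.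
move/eqP: uc; rewrite addrC addr_eq0 => /eqP uc.
move/eqP: vc; rewrite addrC addr_eq0 => /eqP vc.
rewrite uc vc in e'; rewrite -[RHS]addr0 -[X in _ = X + _]e.
rewrite -[X in _ = _ + X]e' /A /B; ring.
Qed.

Let hub_force (x : rest a b + corner) (k : 'I_3) :=
  \sum_h w (split_incl x) (inr (inr h)) *
    (p (split_proj x) 0 k - merged_hub h 0 k).

(** Vertices of [rest a b] have no hub neighbours. The two corners over [a], or over [b], share a
    position and have opposite total weights towards each hub position, so their forces cancel. *)
Lemma merged_hub_force (x : V) (k : 'I_3) :
  \sum_(y | split_proj y == x) hub_force y k = 0.
Proof.
have WC z t : W z t = W t z by apply: (stress_sym stress_w).
have [ca2_0 cb2_0 ca1_0 cb1_0] := merged_hc_corner; have [ca cb] := merged_hc.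
have [ua ub _] := merged_hu; have [va vb _] := merged_hv.
rewrite big_sumType /= [X in X + _]big1 ?add0r => [|s _]; last first.
  by rewrite /hub_force big1 // => h _; rewrite merged_rest_hub mul0r.
rewrite big_mkcond big_corner /=.
have -> : hub_force (inr ca2) k = - hub_force (inr ca1) k.
  apply/eqP; rewrite -addr_eq0; apply/eqP.
  rewrite /hub_force !big_hub /= -!/(W _ _).
  rewrite !(WC (inl _)) ca1_0 ca2_0 /= !mxE.
  move/eqP: ua; rewrite addr_eq0 => /eqP ->; move/eqP: va.
  by rewrite addr_eq0 => /eqP ->; move/eqP: ca; rewrite addr_eq0 => /eqP ->; ring.
have -> : hub_force (inr cb2) k = - hub_force (inr cb1) k.
  apply/eqP; rewrite -addr_eq0; apply/eqP.
  rewrite /hub_force !big_hub /= -!/(W _ _).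
  rewrite !(WC (inl _)) cb1_0 cb2_0 /= !mxE.
  move/eqP: ub; rewrite addr_eq0 => /eqP ->; move/eqP: vb.
  by rewrite addr_eq0 => /eqP ->; move/eqP: cb; rewrite addr_eq0 => /eqP ->; ring.
by case: (a == x); case: (b == x); rewrite ?subrr ?addr0.
Qed.

(** The push-forward of the split-graph weights to [G]. *)
Let pushed (x y : V) : R :=
  \sum_(s | split_proj s == x) \sum_(t | split_proj t == y)
    w (split_incl s) (split_incl t).

(** Vertices over [x] share the position [p x], so the equilibrium sum at [x] collects the
    split-graph terms at all of them; these balance the hub forces, whose sum is zero. *)
Lemma pushed_stress : stress G p pushed.
Proof.
split=> [x y|x y nxy|x k].
- rewrite /pushed exchange_big /=; apply: eq_bigr => t _; apply: eq_bigr => s _.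
  exact: (stress_sym stress_w).
- rewrite /pushed big1 // => s /eqP sx; rewrite big1 // => t /eqP ty.
  apply: (stress_supp stress_w); rewrite glue_incl.
  by apply: contra nxy => /split_proj_adj; rewrite sx ty.
transitivity (\sum_(s | split_proj s == x) \sum_t
    w (split_incl s) (split_incl t) *
      (p (split_proj s) 0 k - p (split_proj t) 0 k)).
  under eq_bigr => y _ do rewrite /pushed mulr_suml.
  rewrite exchange_big /=; apply: eq_bigr => s /eqP sx.
  rewrite [RHS](partition_big split_proj predT) //=; apply: eq_bigr => y _.
  by rewrite mulr_suml; apply: eq_bigr => t /eqP ty; rewrite sx ty.
apply: etrans (_ : - (\sum_(s | split_proj s == x) hub_force s k) = 0); last first.
  by rewrite merged_hub_force oppr0.
rewrite -sumrN; apply: eq_bigr => s _; apply/eqP; rewrite -addr_eq0; apply/eqP.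
rewrite -[RHS](stress_eq stress_w (split_incl s) k) !big_sumType /= addrA.
by congr (_ + _ + _); apply: eq_bigr => t _; rewrite merged_incl.
Qed.

Hypothesis freeG : row_free (rigidity_matrix G p).

(** [pushed] vanishes because [G] has no nonzero stress at [p], and over an edge of the split graph
    it reduces to a single weight by [split_proj_inj]. *)
Lemma merged_split (x y : rest a b + corner) :
  w (split_incl x) (split_incl y) = 0.
Proof.
case xy: (split_graph G a b N x y); last first.
  by apply: (stress_supp stress_w); rewrite glue_incl xy.
have noG := (row_free_stressP _ _).1 freeG _ pushed_stress.
have := noG (split_proj x) (split_proj y).
rewrite /pushed (bigD1 x) //= (bigD1 y) //= => eq0; rewrite -[RHS]eq0.
have out s t : split_proj s = split_proj x -> split_proj t = split_proj y ->
    (s, t) != (x, y) -> w (split_incl s) (split_incl t) = 0.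
  move=> sx ty; apply: contraNeq => nz; apply/eqP.
  case st: (split_graph G a b N s t).
    by have [-> ->] := split_proj_inj xy st sx ty.
  by case/eqP: nz; apply: (stress_supp stress_w); rewrite glue_incl st.
rewrite [X in _ + X + _]big1 ?addr0 => [|t /andP [/eqP ty nt]]; last first.
  by apply: out; rewrite // xpair_eqE eqxx.
rewrite [X in _ + X]big1 ?addr0 // => s /andP [/eqP sx ns].
rewrite big1 // => t /eqP ty; apply: out => //.
by rewrite xpair_eqE (negPf ns).
Qed.

Lemma merged_corner_eq (l : corner) (k : 'I_3) :
  \sum_h W (inl l) (inr h) * (p (corner_old l) 0 k - merged_hub h 0 k) = 0.
Proof.
rewrite -[RHS](stress_eq stress_w (inr (inl l)) k) !big_sumType /=.
rewrite [X in _ = X + _]big1 ?add0r => [|s _]; last first.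
  by rewrite (merged_split (inr l) (inl s)) mul0r.
rewrite [X in _ = X + _]big1 ?add0r // => m _.
by rewrite (merged_split (inr l) (inr m)) mul0r.
Qed.

Lemma merged_corner_hub (l : corner) (h : hub) : W (inl l) (inr h) = 0.
Proof.
have WC z t : W z t = W t z by apply: (stress_sym stress_w).
have [ca2_0 cb2_0 ca1_0 cb1_0] := merged_hc_corner.
pose U := W (inl l) (inr hu); pose X := W (inl l) (inr hv).
pose C := W (inl l) (inr hc) + W (inl l) (inr hc').
(* Each corner is adjacent to only one of c and c', so [C] is a single weight. *)
have CE : C = 0 -> W (inl l) (inr hc) = 0 /\ W (inl l) (inr hc') = 0.
  rewrite /C !(WC (inl l)).
  by case: (l); rewrite ?ca1_0 ?ca2_0 ?cb1_0 ?cb2_0 ?add0r ?addr0.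
suff [U0 X0 /CE [? ?]] : [/\ U = 0, X = 0 & C = 0] by case: h.
have := merged_corner_eq l.
case: l @U @X @C {CE} => U X C eqC.
(* Over a: a - u = -e_2, a - v = -d - e_2, a - c = -e_1. Over b: b - u = d - e_2, b - v = -e_2, b -
   c = d - e_1. *)
1,2: suff [] : [/\ - X = 0, - C = 0 & - (U + X) = 0] by split; lra.
3,4: suff [] : [/\ U + C = 0, - C = 0 & - (U + X) = 0] by split; lra.
all: apply: frame_free => k; rewrite -[RHS](eqC k) big_hub /= !mxE /U /X /C; ring.
Qed.

Lemma merged_stress0 (x y : rest a b + (corner + hub)) : w x y = 0.
Proof.
have WC z t : W z t = W t z by apply: (stress_sym stress_w).
have [uv vu cc' c'c] := merged_hub_hub.
have self h : W (inr h) (inr h) = 0.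
  by apply: merged_butterfly_supp; rewrite double_butterfly_adj_irr.
have hcE h : h = hc \/ h = hc' ->
    W (inr h) (inr hu) = 0 /\ W (inr h) (inr hv) = 0.
  move=> hE; set U := W _ _; set X := W _ _.
  (* The two remaining directions c - u = e_1 - e_2 and c - v = -d + e_1 - e_2 are independent. *)
  suff [] : [/\ - X = 0, U + X = 0 & - (U + X) = 0] by split; lra.
  apply: frame_free => k; have := merged_hub_eq h k.
  rewrite [X in X + _]big1 ?add0r => [<-|l _]; last first.
    by rewrite WC merged_corner_hub mul0r.
  by rewrite big_hub /U /X; case: hE => ->; rewrite ?cc' ?c'c ?self /= !mxE; ring.
have [cu cv] := hcE hc (or_introl erefl).
have [c'u c'v] := hcE hc' (or_intror erefl).
case: x y => [s|[k|h]] [t|[l|i]].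
- exact: (merged_split (inl s) (inl t)).
- exact: (merged_split (inl s) (inr l)).
- exact: merged_rest_hub.
- exact: (merged_split (inr k) (inl t)).
- exact: (merged_split (inr k) (inr l)).
- exact: merged_corner_hub.
- exact: merged_hub_rest.
- by rewrite -/(W _ _) WC merged_corner_hub.
- by rewrite -/(W _ _); case: h i => [] []; rewrite ?self // WC.
Qed.

End Stress.

Lemma row_free_merged :
  row_free (rigidity_matrix G p) ->
  row_free (rigidity_matrix (double_butterfly_split_and_glue G a b N) merged).
Proof.
by move=> freeG; apply/row_free_stressP => w sw x y; apply: merged_stress0.
Qed.

End Degenerate.
End SplitGlue.

(** * Transfer from the merged framework to generic ones *)

Theorem theorem5 (R : realType) (V : finType) (G : sgraph V)
    (hG : independent R G) (a b : V) (N : corner -> {set V})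
    (hN : nonedge_split G a b N) :
  independent R (double_butterfly_split_and_glue G a b N).
Proof.
move=> q gen_q.
(* A copy of [V] among the glued vertices, with a_1 and b_1 standing for [a] and [b], so that
   [q \o g] is a generic framework of [G]. *)
pose g (x : V) : rest a b + (corner + hub) :=
  if insub x is Some s then inl s
  else inr (inl (if x == a then ca1 else cb1)).
have g_inj : injective g.
  move=> x y; rewrite /g.
  case: insubP => [s _ <-|]; case: insubP => [t _ <-|] //; first by case=> ->.
  rewrite !negbK !inE.
  by case/orP=> /eqP ->; case/orP=> /eqP ->; rewrite ?eqxx //;
    case: (b =P a) => [->|].
have gen_p := generic_comp g_inj gen_q.
(* The framework [merged] built on [q \o g] is not generic itself, but its full row rank passes to
   the generic [q]. *)
apply: row_free_generic gen_q; apply: (row_free_merged hN _ (hG _ gen_p)).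
by apply: generic_coord_neq gen_p _; case: hN.
Qed.
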